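(* Let $\mu\ge 1$, let $p,q$ be coprime positive integers, and let $L=T(\mu p,\mu q)\subset S^3$ be the $\mu$-component torus link with link group $G(L)$. Let $\rho:G(L)\to \mathrm{SL}(2,\mathbb{C})$ be an irreducible representation, and let $a,b$ be integers with $0\le a\le p$, $0\le b\le q$ such that, with $\alpha=\exp(\sqrt{-1}\,\pi a/p)$ and $\beta=\exp(\sqrt{-1}\,\pi b/q)$, $\rho(x)$ is conjugate to $\begin{pmatrix}\alpha&0\\0&\alpha^{-1}\end{pmatrix}$ and $\rho(y)$ is conjugate to $\begin{pmatrix}\beta&0\\0&\beta^{-1}\end{pmatrix}$. Let $n\ge1$, let $\rho_n=\sigma_n\circ\rho:G(L)\to\mathrm{SL}(n,\mathbb{C})$, and put $t=t_1\cdots t_\mu$. Then, up to the usual indeterminacy of the twisted Alexander polynomial: If $n$ is even, then $$\Delta_{L,\rho_n}=\frac{\big(t^{pq}-(-1)^a\big)^{n\mu}}{\prod_{j=0}^{\frac n2-1}\left(t^{2q}-2\big(\cos\tfrac{(2j+1)a\pi}{p}\big)t^q+1\right)\left(t^{2p}-2\big(\cos\tfrac{(2j+1)b\pi}{q}\big)t^p+1\right)}.$$ If $n$ is odd, then $$\Delta_{L,\rho_n}=\frac{(t^{pq}-1)^{n\mu}}{(t^p-1)(t^q-1)\prod_{j=1}^{\frac{n-1}2}\left(t^{2q}-2\big(\cos\tfrac{2ja\pi}{p}\big)t^q+1\right)\left(t^{2p}-2\big(\cos\tfrac{2jb\pi}{q}\big)t^p+1\right)}.$$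
   Context: Link group. $G(L)=\pi_1(S^3\setminus \mathrm{int}\,N(L))$, where $N(L)$ is a closed tubular neighbourhood of $L$. For $L=T(\mu p,\mu q)$ it has the presentation $$G(L)=\langle m_1,\ldots,m_\mu,x,y,\ell\mid m_\mu m_{\mu-1}\cdots m_1=x^ry^s,\ [\ell,m_i]=1\ (1\le i\le\mu),\ \ell=x^p=y^q\rangle ,$$ where $r,s$ are integers with $ps+qr=1$, $x,y$ represent the cores of the two solid tori of the genus one Heegaard splitting of $S^3$ given by the standard torus containing $L$, $\ell$ represents a parallel of the torus knot $T(p,q)$ on that torus, and $m_i$ is a meridian of the $i$-th component. Eliminating $m_\mu$ and $\ell$ it reduces to $$G(L)=\langle m_1,\ldots,m_{\mu-1},x,y\mid [x^p,m_i]=1\ (1\le i\le \mu-1),\ x^p=y^q\rangle .$$ The abelianization $\alpha_L:G(L)\to H_1(S^3\setminus \mathrm{int}\,N(L);\mathbb{Z})\cong\langle t_1\rangle\oplus\cdots\oplus\langle t_\mu\rangle\cong\mathbb{Z}^{\mu}$ (written multiplicatively) is $\alpha_L(m_i)=t_i$, $\alpha_L(x)=t^q$, $\alpha_L(y)=t^p$, with $t=t_1\cdots t_\mu$. A representation $\rho:G(L)\to\mathrm{SL}(2,\mathbb{C})$ is irreducible if $\mathbb{C}^2$ has no nontrivial proper $\rho(G(L))$-invariant subspace. The representation $\sigma_n$. Let $V_n=\mathrm{span}_{\mathbb{C}}\langle z_1^{n-1},z_1^{n-2}z_2,\ldots,z_2^{n-1}\rangle$ be the space of homogeneous polynomials of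 degree $n-1$ on $\mathbb{C}^2$. $P\in\mathrm{SL}(2,\mathbb{C})$ acts by $(P\cdot f)(z_1,z_2)=f\big(P^{-1}\begin{pmatrix} z_1 \\ z_2 \end{pmatrix}\big)$; this defines the $n$-dimensional irreducible representation $\sigma_n:\mathrm{SL}(2,\mathbb{C})\to \mathrm{GL}(V_n)$, whose image lies in $\mathrm{SL}(V_n)\cong\mathrm{SL}(n,\mathbb{C})$. Twisted Alexander polynomial (Wada). Let $G(L)=\langle x_1,\ldots,x_l\mid r_1,\ldots,r_{l-1}\rangle$ be a presentation with one fewer relator than generators (e.g. a Wirtinger presentation or the reduced one above), $F_l$ the free group on $x_1,\dots,x_l$, and $\varphi:G(L)\to\mathrm{SL}(n,\mathbb{C})$ a representation. Let $\Phi:\mathbb{Z}[F_l]\to M(n,\mathbb{C}[t_1^{\pm1},\ldots,t_\mu^{\pm1}])$ be the composition of the projection $\mathbb{Z}[F_l]\to\mathbb{Z}[G(L)]$ with the ring homomorphism determined by $g\mapsto \alpha_L(g)\varphi(g)$. Let $A$ be the $(l-1)\times l$ matrix whose $(i,j)$ entry is the $n\times n$ block $\Phi(\partial r_i/\partial x_j)$ (free differential), and let $A_j$ be $A$ with its $j$-th block column removed, regarded as an $n(l-1)\times n(l-1)$ matrix. Then $\Delta_{L,\varphi}(t_1,\ldots,t_\mu)=\det A_j/\det\Phi(x_j-1)$ (for any $j$ with nonzero denominator), a rational function independent of the choice of presentation and well defined up to multiplication by $t_1^{nk_1}\cdots t_\mu^{nk_\mu}$, $k_j\in\mathbb{Z}$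 (and up to sign if $n$ is odd). *)

(* Defs.v *)
From HB Require Import structures.
From mathcomp Require Import all_boot all_order all_algebra.
From mathcomp Require Import reals trigo.
From mathcomp Require Import complex.
From mathcomp Require Import mpoly.

Set Implicit Arguments.
Unset Strict Implicit.
Unset Printing Implicit Defensive.

Import Order.TTheory GRing.Theory Num.Theory.
Local Open Scope ring_scope.
Local Open Scope complex_scope.

(* Elements of the free group on T are represented by (not necessarily
   reduced) words; the letter (i, false) is the generator i and (i, true) is
   its inverse. *)
Definition word (T : Type) := seq (T * bool).

Definition wgen (T : Type) (i : T) : word T := [:: (i, false)].

Definition winv (T : Type) (w : word T) : word T :=
  rev [seq (c.1, ~~ c.2) | c <- w].

Definition wexp (T : Type) (w : word T) (k : nat) : word T :=
  flatten (nseq k w).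

Definition wexpz (T : Type) (w : word T) (z : int) : word T :=
  match z with Posz k => wexp w k | Negz k => wexp (winv w) k.+1 end.

Definition wcomm (T : Type) (u v : word T) : word T :=
  u ++ v ++ winv u ++ winv v.

Definition weval (T : Type) (G : groupType) (g : T -> G) (w : word T) : G :=
  (\prod_(c <- w) (if c.2 then (g c.1)^-1 else g c.1))%g.

(* Two words are [weq rels]-related iff they represent the same element of the
   quotient of the free group on T by the normal closure of the relators. *)
Inductive weq (T : Type) (rels : word T -> Prop) : word T -> word T -> Prop :=
| weq_refl w : weq rels w w
| weq_sym w1 w2 : weq rels w1 w2 -> weq rels w2 w1
| weq_trans w1 w2 w3 : weq rels w1 w2 -> weq rels w2 w3 -> weq rels w1 w3
| weq_cancel u c v : weq rels (u ++ [:: c; (c.1, ~~ c.2)] ++ v) (u ++ v)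
| weq_relator u r v : rels r -> weq rels (u ++ r ++ v) (u ++ v).

(* G = < T | rels >, the generator i : T being the element g i of G. *)
Definition presents (T : Type) (rels : word T -> Prop) (G : groupType)
    (g : T -> G) : Prop :=
  (forall h : G, exists w, weval g w = h) /\
  (forall w1 w2, weval g w1 = weval g w2 <-> weq rels w1 w2).

(* Components are numbered from 0: [gm i] is the meridian m_(i+1). *)
Inductive link_gen (mu : nat) : Type :=
| gm of 'I_mu
| gx
| gy
| gl.
Arguments gx {mu}.
Arguments gy {mu}.
Arguments gl {mu}.

Inductive link_relator (mu p q : nat) (r s : int) : word (link_gen mu) -> Prop :=
| rel_product : link_relator p q r s
    (flatten [seq wgen (gm i) | i <- rev (enum 'I_mu)]
     ++ winv (wexpz (wgen gx) r ++ wexpz (wgen gy) s))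
| rel_commute i : link_relator p q r s (wcomm (wgen gl) (wgen (gm i)))
| rel_lx : link_relator p q r s (wgen gl ++ winv (wexp (wgen gx) p))
| rel_ly : link_relator p q r s (wgen gl ++ winv (wexp (wgen gy) q)).

Definition link_gen_val (mu : nat) (G : Type) (m : 'I_mu -> G) (x y l : G)
    (c : link_gen mu) : G :=
  match c with gm i => m i | gx => x | gy => y | gl => l end.

(* The reduced presentation has the generators m_1, ..., m_(mu-1), x, y, in
   this order, indexed by 'I_mu.+1: x has index mu - 1 and y has index mu. *)
Definition red_gen_val (mu : nat) (G : Type) (m : 'I_mu -> G) (x y : G)
    (i : 'I_mu.+1) : G :=
  if unlift ord_max i is Some k then (if k.+1 == mu then x else m k) else y.

Definition red_relator (mu p q : nat) (i : 'I_mu) : word 'I_mu.+1 :=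
  let X := wexp (wgen (inord mu.-1)) p in
  let Y := wexp (wgen ord_max) q in
  if i.+1 == mu then X ++ winv Y else wcomm X (wgen (lift ord_max i)).

(* The homomorphism G(L) -> H_1 = Z^mu (written additively here) with
   m_i |-> t_i, x |-> t^q, y |-> t^p, where t = t_1 ... t_mu. *)
Definition is_abelianization (mu p q : nat) (G : groupType) (m : 'I_mu -> G)
    (x y : G) (alpha : G -> 'rV[int]_mu) : Prop :=
  [/\ forall g h : G, alpha (g * h)%g = alpha g + alpha h,
      forall i, alpha (m i) = delta_mx 0 i,
      alpha x = const_mx q%:Z
    & alpha y = const_mx p%:Z].

Definition SL_representation (F : fieldType) (n : nat) (G : groupType)
    (phi : G -> 'M[F]_n) : Prop :=
  [/\ phi 1%g = 1%:M,
      forall g h : G, phi (g * h)%g = phi g *m phi h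
    & forall g : G, \det (phi g) = 1].

Definition irreducible_representation (F : fieldType) (n : nat) (G : groupType)
    (phi : G -> 'M[F]_n) : Prop :=
  forall U : {vspace 'cV[F]_n},
    (forall (g : G) (v : 'cV[F]_n), v \in U -> phi g *m v \in U) ->
    U = 0%VS \/ U = fullv.

Definition conjugate_mx (F : fieldType) (n : nat) (A B : 'M[F]_n) : Prop :=
  exists2 P : 'M[F]_n, P \in unitmx & A = P *m B *m invmx P.

Definition expi (R : realType) (theta : R) : R[i] := cos theta +i* sin theta.

Definition diag2 (F : fieldType) (c : F) : 'M[F]_2 :=
  diag_mx (\row_(i < 2) (if i == ord0 then c else c^-1)).

(* (P . f)(z) = f (P^-1 z), for f a polynomial in z = (z_1, z_2). *)
Definition poly_action (F : fieldType) (P : 'M[F]_2) (f : {mpoly F[2]}) :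
    {mpoly F[2]} :=
  f \mPo [tuple \sum_(j < 2) (invmx P) i j *: 'X_j | i < 2].

(* The exponent of z_1^(n-1-k) z_2^k. *)
Definition binary_monom (n k : nat) : 'X_{1..2} :=
  [multinom (if i == ord0 then (n.-1 - k)%N else k) | i < 2].

(* The matrix of the action of P on homogeneous polynomials of degree n - 1, in
   the basis z_1^(n-1), z_1^(n-2) z_2, ..., z_2^(n-1). *)
Definition sigma (F : fieldType) (n : nat) (P : 'M[F]_2) : 'M[F]_n :=
  \matrix_(i < n, j < n)
    (poly_action P 'X_[binary_monom n j])@_(binary_monom n i).

(* C(t_1, ..., t_mu), which contains the Laurent polynomials. *)
Definition ratfun (R : realType) (mu : nat) : fieldType :=
  {fraction {mpoly R[i][mu]}}.

Definition tconst (R : realType) (mu : nat) (c : R[i]) : ratfun R mu :=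
  tofrac (c%:MP).

Definition tvar (R : realType) (mu : nat) (i : 'I_mu) : ratfun R mu :=
  tofrac 'X_i.

Definition tmonom (R : realType) (mu : nat) (v : 'rV[int]_mu) : ratfun R mu :=
  \prod_(i < mu) tvar R i ^ v 0 i.

(* Elements of Z[F_T], as formal sums of words with integer coefficients. *)
Definition wsum (T : Type) := seq (int * word T).

(* The free differential d w / d x_j; for a letter c and a word w one has
   d (c w) / d x_j = d c / d x_j + c (d w / d x_j), with
   d x_j / d x_j = 1 and d x_j^-1 / d x_j = - x_j^-1. *)
Fixpoint fox (T : eqType) (j : T) (w : word T) : wsum T :=
  if w is c :: w' then
    (if c.1 == j then [:: if c.2 then (-1, [:: c]) else (1, [::])] else [::])
    ++ [seq (d.1, c :: d.2) | d <- fox j w']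
  else [::].

Section Wada.
Context (R : realType) (mu n : nat) (G : groupType).
Context (alpha : G -> 'rV[int]_mu) (phi : G -> 'M[R[i]]_n).
Context (k : nat) (g : 'I_k.+1 -> G) (rels : 'I_k -> word 'I_k.+1).

Definition wada_Phi (e : wsum 'I_k.+1) : 'M[ratfun R mu]_n :=
  \sum_(d <- e) (tmonom R (alpha (weval g d.2))
                   *: map_mx (@tconst R mu) (phi (weval g d.2))) *~ d.1.

Definition wada_num (j : 'I_k.+1) : ratfun R mu :=
  \det (\mxblock_(i < k, c < k) wada_Phi (fox (lift j c) (rels i))).

Definition wada_den (j : 'I_k.+1) : ratfun R mu :=
  \det (wada_Phi [:: (1, wgen j); (-1, [::])]).

(* Equality up to multiplication by t_1^(n k_1) ... t_mu^(n k_mu), and up to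
   sign if n is odd. *)
Definition wada_equiv (f h : ratfun R mu) : Prop :=
  exists (e : bool) (z : 'I_mu -> int),
    f = (-1) ^+ (odd n && e) * \prod_(i < mu) tvar R i ^ (n%:Z * z i) * h.

(* F is the twisted Alexander polynomial of (G, alpha, phi), computed from the
   deficiency one presentation of G given by [g] and [rels]. *)
Definition is_twisted_alexander (F : ratfun R mu) : Prop :=
  [/\ presents (fun w => exists i, w = rels i) g,
      exists j, wada_den j != 0
    & forall j, wada_den j != 0 -> wada_equiv (wada_num j / wada_den j) F].

End Wada.

(* Main.v *)
From HB Require Import structures.
Require Import Defs.
From mathcomp Require Import all_boot all_order all_algebra.
From mathcomp Require Import reals trigo.
From mathcomp Require Import complex.
From mathcomp Require Import mpoly.
From mathcomp Require Import ring.
From Stdlib Require Import Setoid Morphisms.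
Set Implicit Arguments.
Unset Strict Implicit.
Unset Printing Implicit Defensive.
Import Order.TTheory GRing.Theory Num.Theory.
Local Open Scope ring_scope.
Local Open Scope complex_scope.

(** Write [Phi] for the twisted representation sending a group element [z] to
    [t^(alpha z) * rho_n z] ([twisted] below), and [D_j w] for the image under
    [Phi] of the free derivative of [w] with respect to the [j]-th generator.

    Eliminating the last meridian and [l] from the presentation of the link
    group leaves the generators [m_1, ..., m_(mu-1), x, y] and the relators
    [[x^p, m_i]] and [x^p y^-q]; this is a Tietze transformation
    ([presents_tietze], [presents_reduced]). Deleting the column of [y] from the
    Alexander matrix leaves a matrix whose only blocks off the diagonal are in
    the column of [x], because [[x^p, m_i]] involves only [x] and [m_i]. Its
    determinant is therefore the product of those of its diagonal blocks
    ([det_mxblock_but_col]). These blocks are [Phi (x^p) - 1], once for each of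
    the [mu - 1] remaining meridians ([torus_block_m]), and [D_x (x^p)], for
    which the fundamental formula of the free differential calculus gives
    [D_x (x^p) * (Phi x - 1) = Phi (x^p) - 1] ([torus_block_x]).

    Since [rho x] is conjugate to [diag(alpha, alpha^-1)] with
    [alpha^p = (-1)^a], the matrix [Phi (x^p)] is the scalar
    [c = (-1)^(a (n-1)) t^(p q)]. So Wada's quotient for the column of [y] is
<<
      (c - 1)^(n mu) / (det (Phi x - 1) * det (Phi y - 1)).
>>
    The two determinants in the denominator come from the eigenvalues
    [alpha^(2 k - (n - 1))], [0 <= k < n], of [sigma_n] on a diagonal matrix
    ([sigma_diag2], [det_twisted_sub1]); pairing opposite exponents produces the
    factors [T^2 - 2 cos(k theta) T + 1] ([weight_prod_even],
    [weight_prod_odd]).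

    The quotient has to be found for every column. Two neighbouring columns are
    compared by [wada_adjacent]: by the fundamental formula the columns [j] and
    [j + 1], multiplied by [Phi x_j - 1] and [Phi x_(j+1) - 1], are opposite
    modulo the other columns, and as the matrices obtained by deleting them
    agree in all other block columns, the quotients differ by [(-1)^n] only.
    Moving from neighbour to neighbour requires all denominators to be nonzero;
    they are, since every generator is mapped to a monomial with nonnegative
    exponents and a positive one, so that [det (Phi x_j - 1)] takes the value
    [(-1)^n] at the origin ([det_monom_sub1_neq0]). *)

(** * Words and presentations *)

Section WordCalculus.
Context (T : Type).
Implicit Types (u v w : word T) (rels : word T -> Prop).

Lemma winv_cat u v : winv (u ++ v) = winv v ++ winv u.
Proof. by rewrite /winv map_cat rev_cat. Qed.

Lemma winv_cons c w : winv (c :: w) = winv w ++ [:: (c.1, ~~ c.2)].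
Proof. by rewrite /winv /= rev_cons -cats1. Qed.

Lemma winvK : involutive (@winv T).
Proof.
move=> w; rewrite /winv map_rev revK -map_comp -[RHS]map_id.
by apply: eq_map => -[i b] /=; rewrite negbK.
Qed.

Lemma weq_cat rels u u' v v' :
  weq rels u u' -> weq rels v v' -> weq rels (u ++ v) (u' ++ v').
Proof.
move=> uu' vv'; apply: (@weq_trans _ _ _ (u' ++ v)).
  elim: uu' => {u u'} [w|w1 w2 _|w1 w2 w3 _ + _|u c w|u r w relr].
  - exact: weq_refl.
  - exact: weq_sym.
  - exact: weq_trans.
  - by rewrite -!catA; apply: weq_cancel.
  - by rewrite -!catA; apply: weq_relator.
elim: vv' => {v v'} [w|w1 w2 _|w1 w2 w3 _ + _|v c w|v r w relr].
- exact: weq_refl.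
- exact: weq_sym.
- exact: weq_trans.
- by rewrite ![u' ++ v ++ _]catA; apply: weq_cancel.
- by rewrite ![u' ++ v ++ _]catA; apply: weq_relator.
Qed.

#[local] Hint Resolve weq_refl : core.

(** Rewriting with [weq rels] is computing in the presented group, without
    constructing that quotient of the free group. *)
#[local] Instance weq_equivalence rels : Equivalence (weq rels).
Proof.
by split; [exact: weq_refl | exact: weq_sym | exact: weq_trans].
Qed.

#[local] Instance weq_cat_proper rels :
  Proper (weq rels ==> weq rels ==> weq rels) (@cat (T * bool)).
Proof. by move=> u u' uu' v v' vv'; apply: weq_cat. Qed.

Lemma weq_mulwV rels w : weq rels (w ++ winv w) [::].
Proof.
elim: w => [|c w IHw]; first exact: weq_refl.
rewrite winv_cons -cat1s catA -(catA [:: c]) IHw /=.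
exact: (weq_cancel _ [::] c [::]).
Qed.

Lemma weq_mulVw rels w : weq rels (winv w ++ w) [::].
Proof. by rewrite -{2}[w]winvK; apply: weq_mulwV. Qed.

Lemma weq_inv rels u v : weq rels u v -> weq rels (winv u) (winv v).
Proof.
move=> uv; rewrite -[winv u]cats0 -(weq_mulwV rels v) -{1}uv catA.
by rewrite weq_mulVw.
Qed.

#[local] Instance weq_inv_proper rels :
  Proper (weq rels ==> weq rels) (@winv T).
Proof. by move=> u v; apply: weq_inv. Qed.

Lemma weq_rel rels r : rels r -> weq rels r [::].
Proof. by move=> relr; have := weq_relator [::] [::] relr; rewrite cats0. Qed.

Lemma weq_mulV_eq1 rels u v : weq rels (u ++ winv v) [::] <-> weq rels u v.
Proof.
split=> [uv|->]; last exact: weq_mulwV.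
by rewrite -[u]cats0 -(weq_mulVw rels v) catA uv.
Qed.

Lemma weq_comm rels u v :
  weq rels (wcomm u v) [::] <-> weq rels (u ++ v) (v ++ u).
Proof.
by rewrite -(weq_mulV_eq1 rels (u ++ v)) winv_cat /wcomm -!catA.
Qed.

(** The elements commuting with [u] form a subgroup. This makes the eliminated
    meridian commute with [x^p]: it is a word in generators that do. *)
Lemma weq_commM rels u v w :
    weq rels (u ++ v) (v ++ u) -> weq rels (u ++ w) (w ++ u) ->
  weq rels (u ++ v ++ w) ((v ++ w) ++ u).
Proof. by move=> uv uw; rewrite catA uv -catA uw catA. Qed.

Lemma weq_commV rels u v :
  weq rels (u ++ v) (v ++ u) -> weq rels (u ++ winv v) (winv v ++ u).
Proof.
move=> uv; rewrite -[u ++ _]/([::] ++ u ++ _) -(weq_mulVw rels v) -!catA.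
by rewrite (catA v) -uv -catA weq_mulwV cats0.
Qed.

Lemma weq_commX rels u v k :
  weq rels (u ++ v) (v ++ u) -> weq rels (u ++ wexp v k) (wexp v k ++ u).
Proof.
move=> uv; elim: k => [|k IHk]; first by rewrite cats0; apply: weq_refl.
exact: weq_commM.
Qed.

Lemma weq_commXz rels u v z :
  weq rels (u ++ v) (v ++ u) -> weq rels (u ++ wexpz v z) (wexpz v z ++ u).
Proof.
by case: z => k uv; apply: weq_commX => //; apply: weq_commV.
Qed.

End WordCalculus.

Definition wsubst (T S : Type) (f : T -> word S) (w : word T) : word S :=
  flatten [seq if c.2 then winv (f c.1) else f c.1 | c <- w].

Section Substitution.
Context (T S : Type) (f : T -> word S).

Lemma wsubst_cat u v : wsubst f (u ++ v) = wsubst f u ++ wsubst f v.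
Proof. by rewrite /wsubst map_cat flatten_cat. Qed.

Lemma wsubst_wgen c : wsubst f (wgen c) = f c.
Proof. exact: cats0. Qed.

Lemma wsubst_inv w : wsubst f (winv w) = winv (wsubst f w).
Proof.
elim: w => // -[c b] w IHw.
rewrite winv_cons wsubst_cat IHw -[(c, b) :: w]cat1s wsubst_cat winv_cat.
congr (_ ++ _).
by rewrite /wsubst /= !cats0; case: b => //=; rewrite winvK.
Qed.

Lemma wsubst_exp w k : wsubst f (wexp w k) = wexp (wsubst f w) k.
Proof. by elim: k => // k IHk; rewrite /wexp /= wsubst_cat -/(wexp w k) IHk. Qed.

Lemma wsubst_expz w z : wsubst f (wexpz w z) = wexpz (wsubst f w) z.
Proof. by case: z => k; rewrite /= wsubst_exp ?wsubst_inv. Qed.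

Lemma wsubst_flatten (ws : seq (word T)) :
  wsubst f (flatten ws) = flatten (map (wsubst f) ws).
Proof. by elim: ws => //= w ws <-; rewrite wsubst_cat. Qed.

Lemma weq_wsubst (rels : word T -> Prop) (rels' : word S -> Prop) u v :
    (forall r, rels r -> weq rels' (wsubst f r) [::]) ->
  weq rels u v -> weq rels' (wsubst f u) (wsubst f v).
Proof.
move=> relP; elim=> {u v} [w|w1 w2 _|w1 w2 w3 _ + _|u c w|u r w relr].
- exact: weq_refl.
- exact: weq_sym.
- exact: weq_trans.
- rewrite !wsubst_cat; apply: weq_cat; first exact: weq_refl.
  apply: (weq_cat (u' := [::])); last exact: weq_refl.
  rewrite /wsubst /= cats0; case: c.2; first exact: weq_mulVw.
  exact: weq_mulwV.
- rewrite !wsubst_cat; apply: weq_cat; first exact: weq_refl.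
  by apply: (weq_cat (u' := [::])); [exact: relP | exact: weq_refl].
Qed.

End Substitution.

Section Evaluation.
Context (T : Type) (G : groupType) (g : T -> G).
Local Open Scope group_scope.

Lemma weval_cat u v : weval g (u ++ v) = weval g u * weval g v.
Proof. by rewrite /weval big_cat. Qed.

Lemma weval_nil : weval g [::] = 1.
Proof. by rewrite /weval big_nil. Qed.

Lemma weval_wgen i : weval g (wgen i) = g i.
Proof. by rewrite /weval big_seq1. Qed.

Lemma weval_inv w : weval g (winv w) = (weval g w)^-1.
Proof.
elim: w => [|[c b] w IHw]; first by rewrite /weval !big_nil invg1.
rewrite winv_cons weval_cat IHw -[_ :: w]cat1s weval_cat invgM; congr (_ * _).
by rewrite /weval !big_seq1 /=; case: b; rewrite /= ?invgK.
Qed.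

Lemma weval_exp w k : weval g (wexp w k) = weval g w ^+ k.
Proof.
elim: k => [|k IHk]; first exact: weval_nil.
by rewrite expgS -IHk -weval_cat.
Qed.

Lemma weval_comm_eq1 u v :
  weval g (wcomm u v) = 1 <-> commute (weval g u) (weval g v).
Proof.
rewrite /wcomm !weval_cat !weval_inv -invgM mulgA.
split=> [uv1|->]; last by rewrite mulgV.
by rewrite /commute -[LHS](mulgVK (weval g v * weval g u)) uv1 mul1g.
Qed.

Lemma weq_weval (rels : word T -> Prop) u v :
  (forall r, rels r -> weval g r = 1) -> weq rels u v ->
  weval g u = weval g v.
Proof.
move=> relP; elim=> {u v} [//|w1 w2 _ -> //|w1 w2 w3 _ -> //|u c w|u r w relr].
- have cc1 : weval g [:: c; (c.1, ~~ c.2)] = 1.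
    rewrite /weval big_cons big_seq1.
    by case: c => c [] /=; rewrite ?mulVg ?mulgV.
  by rewrite !weval_cat cc1 mul1g.
- by rewrite !weval_cat (relP r) // mul1g.
Qed.

End Evaluation.

Lemma weval_wsubst (T S : Type) (G : groupType) (h : S -> G) (f : T -> word S)
    (w : word T) :
  weval h (wsubst f w) = weval (fun c => weval h (f c)) w.
Proof.
elim: w => [|[c b] w IHw]; first by rewrite !weval_nil.
rewrite -cat1s wsubst_cat !weval_cat IHw; congr (_ * _)%g.
rewrite weval_nil mulg1 {2}/weval big_seq1 /=.
by case: b => //; rewrite weval_inv.
Qed.

(** A Tietze transformation: [f] and [e] rewrite the generators of the two
    presentations in terms of each other. An identity of [G] between words in
    the [h i] is carried by [e] to a consequence of [rels], hence by [f] to a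
    consequence of [rels'], and [f] after [e] is the identity modulo [rels']. *)
Lemma presents_tietze (T S : Type) (G : groupType)
    (rels : word T -> Prop) (rels' : word S -> Prop) (g : T -> G) (h : S -> G)
    (f : T -> word S) (e : S -> word T) :
    presents rels g ->
    (forall c, weval h (f c) = g c) -> (forall i, weval g (e i) = h i) ->
    (forall r, rels' r -> weval h r = 1%g) ->
    (forall r, rels r -> weq rels' (wsubst f r) [::]) ->
    (forall i, weq rels' (wsubst f (e i)) (wgen i)) ->
  presents rels' h.
Proof.
move=> [g_onto g_rels] hf ge rel'P relP fe.
have weval_eq (U : Type) (k k' : U -> G) w :
    (forall c, k c = k' c) -> weval k w = weval k' w.
  by move=> kk'; apply: eq_bigr => c _; rewrite kk'.
split=> [z|w1 w2].
  have [w <-] := g_onto z; exists (wsubst f w).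
  by rewrite weval_wsubst; apply: weval_eq.
split; last exact: weq_weval.
rewrite -!(weval_eq _ _ _ _ ge) -!weval_wsubst => /g_rels /(weq_wsubst relP).
have fe_id w : weq rels' (wsubst f (wsubst e w)) w.
  elim: w => [|[i b] w IHw]; first exact: weq_refl.
  rewrite -cat1s !wsubst_cat; apply: weq_cat IHw.
  rewrite {2}/wsubst /= cats0; case: b => //.
  by rewrite wsubst_inv; apply: (weq_inv (fe i)).
move=> w12; apply: weq_trans (fe_id w2); apply: weq_trans w12.
exact: weq_sym.
Qed.

(** * The reduced presentation of the link group *)

#[local] Existing Instances weq_equivalence weq_cat_proper weq_inv_proper.
#[local] Hint Resolve weq_refl : core.

(** The last meridian, solved for in the product relation. *)
Definition last_meridian_word (nu : nat) (r s : int) : word 'I_nu.+2 :=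
  wexpz (wgen (lift ord_max ord_max)) r ++ wexpz (wgen ord_max) s
  ++ winv (flatten [seq wgen (lift ord_max (widen_ord (leqnSn nu) i))
                   | i <- rev (enum 'I_nu)]).

(** The generators of the full presentation as words in those of the reduced
    one: [lift ord_max ord_max] is [x], [ord_max] is [y], and the other
    [lift ord_max i] are the meridians that are kept. *)
Definition link_gen_word (nu p : nat) (r s : int) (c : link_gen nu.+1) :
    word 'I_nu.+2 :=
  match c with
  | gm i => if i == ord_max then last_meridian_word nu r s
            else wgen (lift ord_max i)
  | gx => wgen (lift ord_max ord_max)
  | gy => wgen ord_max
  | gl => wexp (wgen (lift ord_max ord_max)) p
  end.

Lemma inord_lift_max nu : inord nu = lift ord_max ord_max :> 'I_nu.+2.
Proof. by apply: val_inj; rewrite /= inordK // /bump ltnn. Qed.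

Lemma red_gen_val_x nu (A : Type) (m : 'I_nu.+1 -> A) x y :
  red_gen_val m x y (lift ord_max ord_max) = x.
Proof. by rewrite /red_gen_val liftK eqxx. Qed.

Lemma red_gen_val_y nu (A : Type) (m : 'I_nu.+1 -> A) x y :
  red_gen_val m x y ord_max = y.
Proof. by rewrite /red_gen_val unlift_none. Qed.

Lemma red_gen_val_m nu (A : Type) (m : 'I_nu.+1 -> A) x y i :
  i != ord_max -> red_gen_val m x y (lift ord_max i) = m i.
Proof. by rewrite /red_gen_val liftK eqSS -(inj_eq val_inj) => /negPf/= ->. Qed.

Lemma red_relator_xy nu p q : @red_relator nu.+1 p q ord_max =
  wexp (wgen (lift ord_max ord_max)) p ++ winv (wexp (wgen ord_max) q).
Proof. by rewrite /red_relator eqxx /= inord_lift_max. Qed.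

Lemma red_relator_m nu p q i : i != ord_max -> @red_relator nu.+1 p q i =
  wcomm (wexp (wgen (lift ord_max ord_max)) p) (wgen (lift ord_max i)).
Proof.
rewrite /red_relator eqSS -(inj_eq val_inj) => /negPf/= ->.
by rewrite inord_lift_max.
Qed.

Lemma rev_enum_ordSr nu : rev (enum 'I_nu.+1) =
  ord_max :: [seq widen_ord (leqnSn nu) i | i <- rev (enum 'I_nu)].
Proof. by rewrite enum_ordSr rev_rcons -map_rev. Qed.

Lemma widen_ord_neq_max nu (i : 'I_nu) : widen_ord (leqnSn nu) i != ord_max.
Proof. by rewrite -(inj_eq val_inj) /= neq_ltn ltn_ord. Qed.

Lemma weval_expz (T : Type) (G : groupType) (g : T -> G) w z :
  weval g (wexpz w z)
  = match z with Posz k => (weval g w ^+ k)%g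
    | Negz k => ((weval g w)^-1 ^+ k.+1)%g end.
Proof. by case: z => k; rewrite weval_exp ?weval_inv. Qed.

Lemma weval_flatten_gen (T U : Type) (G : groupType) (g : T -> G) (g' : U -> G)
    (I : Type) (f : I -> T) (f' : I -> U) s :
  (forall i, g (f i) = g' (f' i)) ->
  weval g (flatten [seq wgen (f i) | i <- s])
  = weval g' (flatten [seq wgen (f' i) | i <- s]).
Proof.
move=> gf; elim: s => [|i s IHs]; first by rewrite !weval_nil.
by rewrite !weval_cat !weval_wgen gf IHs.
Qed.

(** The product relation is solved for the last meridian and [l = x^p] for
    [l], so both become trivial. The only other relator that does not become a
    reduced one is [[l, m_mu]]; it follows from them, since they make [x^p]
    central. *)
Lemma presents_reduced nu p q r s (G : groupType) (m : 'I_nu.+1 -> G) x y l :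
    presents (@link_relator nu.+1 p q r s) (link_gen_val m x y l) ->
  presents (fun w => exists i, w = red_relator p q i) (red_gen_val m x y).
Proof.
move=> pG; have [_ G_rels] := pG.
have relG w : @link_relator nu.+1 p q r s w -> weval (link_gen_val m x y l) w = 1%g.
  by move=> relw; rewrite -(weval_nil (link_gen_val m x y l)); apply/G_rels/weq_rel.
have lx : l = (x ^+ p)%g.
  have /relG := @rel_lx nu.+1 p q r s.
  rewrite weval_cat weval_inv weval_exp !weval_wgen /= => /(congr1 (fun z => (z * x ^+ p)%g)).
  by rewrite mulgVK mul1g.
have ly : l = (y ^+ q)%g.
  have /relG := @rel_ly nu.+1 p q r s.
  rewrite weval_cat weval_inv weval_exp !weval_wgen /= => /(congr1 (fun z => (z * y ^+ q)%g)).
  by rewrite mulgVK mul1g.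
have flatten_cons T (w : seq T) ws : flatten (w :: ws) = w ++ flatten ws by [].
set rels' := fun w => _.
(* The element [x^p], which is central in the group of the reduced relators. *)
pose X : word 'I_nu.+2 := wexp (wgen (lift ord_max ord_max)) p.
have Xy : weq rels' X (wexp (wgen ord_max) q).
  by apply/weq_mulV_eq1/weq_rel; exists ord_max; rewrite red_relator_xy.
have Xcomm_m i : i != ord_max ->
    weq rels' (X ++ wgen (lift ord_max i)) (wgen (lift ord_max i) ++ X).
  by move=> iP; apply/weq_comm/weq_rel; exists i; rewrite red_relator_m.
have comm_refl (u : word 'I_nu.+2) : weq rels' (u ++ u) (u ++ u) by [].
have Xcomm_x : weq rels' (X ++ wgen (lift ord_max ord_max))
                         (wgen (lift ord_max ord_max) ++ X).
  by apply: weq_sym; apply: weq_commX.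
have Xcomm_y : weq rels' (X ++ wgen ord_max) (wgen ord_max ++ X).
  by rewrite Xy; apply: weq_sym; apply: weq_commX.
apply: (presents_tietze (f := link_gen_word p r s)
   (e := red_gen_val (fun i => wgen (gm i)) (wgen gx) (wgen gy)) pG).
- case=> [i|||]; rewrite /link_gen_word ?weval_exp ?weval_wgen ?red_gen_val_x
    ?red_gen_val_y -?lx //.
  case: eqP => [->|/eqP iP]; last by rewrite weval_wgen red_gen_val_m.
  rewrite !weval_cat weval_inv.
  have /relG := @rel_product nu.+1 p q r s.
  rewrite rev_enum_ordSr map_cons -map_comp flatten_cons.
  rewrite !weval_cat weval_inv weval_cat.
  rewrite !weval_expz !weval_wgen /= red_gen_val_x red_gen_val_y.
  set a := (match r with Posz _ => _ | Negz _ => _ end).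
  set b := (match s with Posz _ => _ | Negz _ => _ end).
  rewrite (weval_flatten_gen (g' := link_gen_val m x y l)
     (f' := fun i => gm (widen_ord (leqnSn nu) i))); last first.
    by move=> j; rewrite red_gen_val_m // widen_ord_neq_max.
  set c := weval _ _ => /(congr1 (fun z => z * (a * b) * c^-1)%g).
  by rewrite mul1g mulgVK mulgK => ->; rewrite mulgA.
- move=> i; case: (unliftP ord_max i) => [j|] ->.
    case: (eqVneq j ord_max) => [->|jP]; first by rewrite !red_gen_val_x weval_wgen.
    by rewrite !red_gen_val_m // weval_wgen.
  by rewrite !red_gen_val_y weval_wgen.
- move=> _ [i ->]; case: (eqVneq i ord_max) => [->|iP].
    rewrite red_relator_xy weval_cat weval_inv !weval_exp !weval_wgen.
    by rewrite red_gen_val_x red_gen_val_y -lx -ly mulgV.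
  rewrite red_relator_m //; apply/weval_comm_eq1.
  rewrite !weval_exp !weval_wgen red_gen_val_x red_gen_val_m // -lx.
  have /relG/weval_comm_eq1 := @rel_commute nu.+1 p q r s i.
  by rewrite !weval_wgen.
- move=> w; case=> [|i||].
  + rewrite wsubst_cat wsubst_inv wsubst_cat !wsubst_expz !wsubst_wgen.
    rewrite wsubst_flatten rev_enum_ordSr -!map_comp /= wsubst_wgen /= eqxx.
    apply/weq_mulV_eq1; rewrite /last_meridian_word -!catA.
    set w1 := flatten _; set w2 := flatten _; have -> : w2 = w1.
      congr flatten; rewrite -map_comp; apply: eq_map => i /=; rewrite wsubst_wgen /=.
      by rewrite (negPf (widen_ord_neq_max i)).
    by rewrite weq_mulVw cats0.
  + rewrite /wcomm !wsubst_cat !wsubst_inv !wsubst_wgen /=.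
    apply/weq_comm; rewrite -/X; case: eqP => [_|/eqP]; last exact: Xcomm_m.
    rewrite /last_meridian_word; apply: weq_commM; first exact: weq_commXz.
    apply: weq_commM; first exact: weq_commXz.
    apply: weq_commV; elim: (rev _) => [|j js IHs]; first by rewrite cats0.
    by apply: weq_commM => //; apply/Xcomm_m/widen_ord_neq_max.
  + rewrite !wsubst_cat !wsubst_inv wsubst_exp !wsubst_wgen.
    exact: weq_mulwV.
  + rewrite !wsubst_cat !wsubst_inv wsubst_exp !wsubst_wgen.
    exact/weq_mulV_eq1.
- move=> i; case: (unliftP ord_max i) => [j|] ->.
    case: (eqVneq j ord_max) => [->|jP]; first by rewrite !red_gen_val_x wsubst_wgen.
    by rewrite red_gen_val_m // wsubst_wgen /= (negPf jP).
  by rewrite !red_gen_val_y wsubst_wgen.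
Qed.

(** * Determinants of block matrices *)

Lemma det_castmx (R : comNzRingType) m n (e : m = n) (A : 'M[R]_m) :
  \det (castmx (e, e) A) = \det A.
Proof. by case: _ / e; rewrite castmx_id. Qed.

(** Peel off the first block row and column. If the exceptional column [j] is
    the first one, the rest of the first row vanishes; otherwise the rest of the
    first column does, and the exceptional column moves to [j.-1]. Letting [j] be
    a natural number allows there to be no exceptional column. *)
Lemma det_mxblock_but_col (R : comNzRingType) n k (j : nat)
    (B : 'I_k -> 'I_k -> 'M[R]_n) :
    (forall i c : 'I_k, i != c -> c != j :> nat -> B i c = 0) ->
  \det (\mxblock_(i < k, c < k) B i c) = \prod_(i < k) \det (B i i).
Proof.
elim: k j B => [|k IHk] j B B0.
  rewrite big_ord0; move: (mxblock _).
  by rewrite !big_ord0 => A; apply: det_mx00.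
rewrite mxblock_recul det_castmx big_ord_recl.
have [j0|jn0] := eqVneq j 0%N.
  have -> : \mxrow_c B ord0 (lift ord0 c) = 0.
    by rewrite -[RHS]mxrow0; apply: eq_mxrow => c; apply: B0; rewrite // j0.
  rewrite det_lblock; congr (_ * _); apply: (IHk k) => i c ic _.
  by apply: B0; rewrite ?(inj_eq lift_inj) // j0.
have -> : \mxcol_i B (lift ord0 i) ord0 = 0.
  by rewrite -[RHS]mxcol0; apply: eq_mxcol => i; apply: B0; rewrite //= eq_sym.
rewrite det_ublock; congr (_ * _); apply: (IHk j.-1) => i c ic cj.
apply: B0; rewrite ?(inj_eq lift_inj) //.
by rewrite /= /bump /= add1n -(prednK (n := j)) ?lt0n // eqSS.
Qed.

(** With the columns [j] or [j + 1] deleted, the two block matrices differ in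
    the block column in position [j] only. Multiply the first by the identity
    with its column [j] replaced by the other [b c]: by the hypothesis, column
    [j] becomes [- A i j0 *m b j0], which is also obtained from the second by
    multiplying its column [j] by [- b j0]. *)
Lemma wada_adjacent (R : comNzRingType) n k
    (A : 'I_k -> 'I_k.+1 -> 'M[R]_n) (b : 'I_k.+1 -> 'M[R]_n) (j : 'I_k)
    (j0 := widen_ord (leqnSn k) j) (j1 := lift ord0 j) :
    (forall i, \sum_c A i c *m b c = 0) ->
  \det (\mxblock_(i < k, c < k) A i (lift j0 c)) * \det (b j1) =
  \det (\mxblock_(i < k, c < k) A i (lift j1 c)) * ((-1) ^+ n * \det (b j0)).
Proof.
move=> Ab0.
pose W c c' := if c' == j then b (lift j0 c) else (c == c')%:R%:M.
pose W' c c' := if c' == j then (if c == j then - b j0 else 0) else (c == c')%:R%:M.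
have lift0j : lift j0 j = j1 by apply: val_inj; rewrite /= /bump leqnn.
have lift1j : lift j1 j = j0 by apply: val_inj; rewrite /= /bump /= add1n ltnn.
have detW : \det (\mxblock_(c < k, c' < k) W c c') = \det (b j1).
  rewrite (@det_mxblock_but_col _ _ _ j) => [|c c' cc' c'j]; last first.
    by rewrite /W ifN // (negPf cc') raddf0.
  rewrite (bigD1 j) //= {1}/W eqxx lift0j big1 ?mulr1 // => c /negPf cj.
  by rewrite /W cj eqxx det1.
have detW' : \det (\mxblock_(c < k, c' < k) W' c c') = (-1) ^+ n * \det (b j0).
  rewrite (@det_mxblock_but_col _ _ _ j) => [|c c' cc' c'j]; last first.
    by rewrite /W' ifN // (negPf cc') raddf0.
  rewrite (bigD1 j) //= {1}/W' eqxx big1 ?mulr1 => [|c /negPf cj].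
    by rewrite -scaleN1r detZ.
  by rewrite /W' cj eqxx det1.
rewrite -detW -detW' -!det_mulmx !mul_mxblock; congr (\det _).
apply: eq_mxblock => i c; case: (eqVneq c j) => [->|cj].
  under eq_bigr do rewrite /W eqxx.
  under [RHS]eq_bigr do rewrite /W' eqxx.
  rewrite [RHS](bigD1 j) //= eqxx lift1j [X in _ + X]big1 => [|d /negPf->]; last first.
    by rewrite mulmx0.
  rewrite addr0 mulmxN; apply/eqP; rewrite -addr_eq0; apply/eqP.
  by rewrite -[RHS](Ab0 i) (bigD1_ord j0) //= addrC.
have delta_sum (F : 'I_k -> 'M[R]_n) : \sum_d F d *m (d == c)%:R%:M = F c.
  rewrite (bigD1 c) //= eqxx mulmx1 big1 ?addr0 // => d /negPf->.
  by rewrite raddf0 mulmx0.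
under eq_bigr do rewrite /W (negPf cj).
under [RHS]eq_bigr do rewrite /W' (negPf cj).
rewrite !delta_sum; congr (A i _); apply: val_inj; rewrite /= /bump /= add1n.
by rewrite ltn_neqAle (eq_sym (val j)) cj.
Qed.

(** Iterate [wada_adjacent] from column [j] to the last one; each step divides by
    [\det (b c)] for an intermediate [c]. *)
Lemma wada_column (F : fieldType) n k
    (A : 'I_k -> 'I_k.+1 -> 'M[F]_n) (b : 'I_k.+1 -> 'M[F]_n) (j : 'I_k.+1) :
    (forall i, \sum_c A i c *m b c = 0) -> (forall c, \det (b c) != 0) ->
  \det (\mxblock_(i < k, c < k) A i (lift j c)) / \det (b j) =
  (-1) ^+ (n * (k - j)) *
    (\det (\mxblock_(i < k, c < k) A i (lift ord_max c)) / \det (b ord_max)).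
Proof.
move=> Ab0 b0.
have [d] := ubnPeq (k - j)%N; elim: d j => [|d IHd] j /eqP jd.
  suff -> : j = ord_max by rewrite muln0 mul1r.
  apply/val_inj/eqP; rewrite eqn_leq leq_ord /= -subn_eq0.
  exact/eqP.
have jk : (j < k)%N by rewrite -subn_gt0 jd.
have := wada_adjacent (Ordinal jk) Ab0.
have -> : widen_ord (leqnSn k) (Ordinal jk) = j by apply: val_inj.
set j1 := lift _ _; have j1E : j1 = j.+1 :> nat by rewrite /= /bump add1n.
move=> adj; rewrite mulnS exprD -mulrA -(IHd j1) ?j1E ?subnS ?jd //.
apply: (mulIf (b0 j1)); apply: (mulIf (b0 j)).
rewrite [LHS]mulrAC divfK // adj -(mulrA ((-1) ^+ n)) divfK //.
by rewrite mulrCA mulrA.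
Qed.

(** * Binary forms *)

Lemma invmx_mul (F : fieldType) n (A B : 'M[F]_n) :
  A \in unitmx -> B \in unitmx -> invmx (A *m B) = invmx B *m invmx A.
Proof.
move=> Au Bu; have ABu : A *m B \in unitmx by rewrite unitmx_mul Au.
by rewrite -[RHS](mulmxK ABu) -(mulmxA (invmx B)) mulKmx // mulVmx // mul1mx.
Qed.

Section BinaryForms.
Context (F : fieldType) (n : nat).
Implicit Types (P Q : 'M[F]_2) (f : {mpoly F[2]}).

Lemma poly_action1 f : poly_action 1%:M f = f.
Proof.
rewrite /poly_action invmx1 -[RHS]comp_mpoly_id; congr comp_mpoly.
apply: eq_mktuple => i; rewrite (bigD1 i) //= mxE eqxx scale1r big1 ?addr0 //.
by move=> j ji; rewrite mxE eq_sym (negPf ji) scale0r.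
Qed.

(** [P^-1] and substitution both reverse the order of composition. *)
Lemma poly_actionM P Q f : P \in unitmx -> Q \in unitmx ->
  poly_action (P *m Q) f = poly_action P (poly_action Q f).
Proof.
move=> Pu Qu; rewrite /poly_action (invmx_mul Pu Qu).
rewrite (comp_mpolyEX f) (comp_mpolyEX f (mktuple _)) raddf_sum /=.
apply: eq_bigr => k _; rewrite comp_mpolyZ; congr (_ *: _).
rewrite !comp_mpolyX rmorph_prod; apply: eq_bigr => i _ /=.
rewrite rmorphXn /=; congr (_ ^+ _); rewrite !tnth_mktuple raddf_sum /=.
under [RHS]eq_bigr => j _ do
  rewrite comp_mpolyZ comp_mpolyXU nth_mktuple scaler_sumr.
rewrite exchange_big; apply: eq_bigr => j _ /=; rewrite mxE scaler_suml.
by apply: eq_bigr => l _; rewrite scalerA.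
Qed.

Lemma binary_monom0 k : binary_monom n k ord0 = (n.-1 - k)%N.
Proof. by rewrite mnmE. Qed.

Lemma binary_monom1 k : binary_monom n k ord_max = k.
Proof. by rewrite mnmE. Qed.

Lemma mdeg2 (m : 'X_{1..2}) : mdeg m = (m ord0 + m ord_max)%N.
Proof. by rewrite mdegE big_ord_recr big_ord1; congr (m _ + _)%N; apply: val_inj. Qed.

Lemma mdeg_binary_monom (k : 'I_n) : mdeg (binary_monom n k) = n.-1.
Proof.
by rewrite mdeg2 binary_monom0 binary_monom1 subnK // -ltnS (ltn_predK (ltn_ord k)).
Qed.

Lemma binary_monom_inj (i j : 'I_n) :
  (binary_monom n i == binary_monom n j) = (i == j).
Proof.
apply/eqP/eqP => [/mnmP/(_ ord_max)|->//].
by rewrite !binary_monom1 => /val_inj.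
Qed.

Lemma binary_monomP (m : 'X_{1..2}) : (0 < n)%N -> mdeg m = n.-1 ->
  exists k : 'I_n, m = binary_monom n k.
Proof.
move=> n0; rewrite mdeg2 => mE.
have lt_m : (m ord_max < n)%N by rewrite -(prednK n0) ltnS -mE leq_addl.
exists (Ordinal lt_m); apply/mnmP => i; rewrite mnmE.
case: eqP => [->|/eqP i0]; first by rewrite -mE addnK.
by congr (m _); apply: val_inj; case: i i0 => -[|[]].
Qed.

(** The monomials [binary_monom n k] form a basis of the forms of degree
    [n - 1], which makes [sigma n P] the matrix of an endomorphism. *)
Lemma homog_binary_form f : (0 < n)%N -> f \is n.-1.-homog ->
  f = \sum_(k < n) f@_(binary_monom n k) *: 'X_[binary_monom n k].
Proof.
move=> n0 fh; apply/mpolyP => m; rewrite raddf_sum /=.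
under eq_bigr do rewrite mcoeffZ mcoeffX.
have [mn|mn] := eqVneq (mdeg m) n.-1.
  have [k ->] := binary_monomP n0 mn.
  rewrite (bigD1 k) //= eqxx mulr1 big1 ?addr0 // => i ik.
  by rewrite binary_monom_inj (negPf ik) mulr0.
rewrite (dhomog_nemf_coeff fh) // big1 // => i _.
have [im|_] := eqVneq (binary_monom n i) m; last by rewrite mulr0.
by move: mn; rewrite -im mdeg_binary_monom eqxx.
Qed.

Lemma poly_action_homog P (k : 'I_n) :
  poly_action P 'X_[binary_monom n k] \is n.-1.-homog.
Proof.
rewrite /poly_action comp_mpolyX big_ord_recr big_ord1 /=.
rewrite -(mdeg_binary_monom k) mdeg2.
set z := widen_ord _ _; have -> : z = ord0 by apply: val_inj.
have lin_homog i : tnth [tuple \sum_(j < 2) invmx P i j *: 'X_j | i < 2] i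
    \is 1.-homog.
  rewrite tnth_mktuple; apply: rpred_sum => j _; apply: rpredZ.
  by rewrite dhomogX /= mdeg1.
by apply: dhomogM; rewrite -[X in X.-homog]mul1n; apply: dhomogMn.
Qed.

Lemma sigmaE P i j :
  sigma n P i j = (poly_action P 'X_[binary_monom n j])@_(binary_monom n i).
Proof. by rewrite mxE. Qed.

Lemma sigma1 : sigma n (1%:M : 'M[F]_2) = 1%:M.
Proof.
apply/matrixP => i j.
by rewrite sigmaE mxE poly_action1 mcoeffX binary_monom_inj eq_sym.
Qed.

Lemma sigmaM P Q : P \in unitmx -> Q \in unitmx ->
  sigma n (P *m Q) = sigma n P *m sigma n Q.
Proof.
move=> Pu Qu; apply/matrixP => i j.
rewrite sigmaE [RHS]mxE (poly_actionM _ Pu Qu).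
have n0 : (0 < n)%N by case: n i => [[]|].
rewrite (homog_binary_form n0 (poly_action_homog Q j)).
rewrite [poly_action P _]raddf_sum raddf_sum; apply: eq_bigr => k _.
rewrite [RHS]mulrC [X in X * _]sigmaE [X in _ * X]sigmaE.
apply: etrans (mcoeffZ _ _ _); exact: congr1 (comp_mpolyZ _ _ _).
Qed.

Lemma diag2_unit (c : F) : c != 0 -> diag2 c \in unitmx.
Proof.
move=> c0; rewrite unitmxE det_diag big_ord_recr big_ord1 !mxE /= divff //.
exact: unitr1.
Qed.

Lemma invmx_diag2 (c : F) : c != 0 -> invmx (diag2 c) = diag2 c^-1.
Proof.
move=> c0; have cu := diag2_unit c0.
suff cVc : diag2 c^-1 *m diag2 c = 1%:M by rewrite -[RHS](mulmxK cu) cVc mul1mx.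
rewrite mulmx_diag -diag_const_mx; congr diag_mx; apply/rowP => i.
by rewrite !mxE; case: eqP => _; rewrite mulVf ?invr_eq0.
Qed.

Lemma sigma_diag2 (c : F) : c != 0 ->
  sigma n (diag2 c) = diag_mx (\row_(k < n) (c ^- (n.-1 - k) * c ^+ k)).
Proof.
move=> c0; apply/matrixP => i j; rewrite !mxE /poly_action invmx_diag2 //.
rewrite comp_mpolyX.
under eq_bigr => k _.
  rewrite tnth_mktuple (bigD1 k) //= big1 ?addr0 => [|l lk]; last first.
    by rewrite mxE (eq_sym k) (negPf lk) mulr0n scale0r.
  rewrite !mxE eqxx mulr1n exprZn.
  over.
rewrite scaler_prod -mpolyXE_id mcoeffZ mcoeffX binary_monom_inj big_ord_recr big_ord1.
have -> : widen_ord (leqnSn 1) ord0 = ord0 :> 'I_2 by apply: val_inj.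
rewrite /= invrK binary_monom0 binary_monom1 exprVn eq_sym.
by case: eqP => [->|_]; rewrite ?mulr1 ?mulr1n ?mulr0 ?mulr0n.
Qed.
End BinaryForms.

(** * Twisted free differential calculus *)

HB.instance Definition _ (R : realType) mu :=
  GRing.RMorphism.copy (@tconst R mu)
    (@tofrac {mpoly R[i][mu]} \o @mpolyC mu R[i]).

Section Monomials.
Context (R : realType) (mu : nat).

Lemma tvar_neq0 (i : 'I_mu) : tvar R i != 0.
Proof.
rewrite tofrac_eq0; apply/eqP => /(congr1 (mcoeff U_(i)%MM))/eqP.
by rewrite mcoeffX mcoeff0 eqxx oner_eq0.
Qed.

Lemma tmonomD (u v : 'rV[int]_mu) : tmonom R (u + v) = tmonom R u * tmonom R v.
Proof.
rewrite /tmonom -big_split; apply: eq_bigr => i _ /=.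
by rewrite mxE expfzDr // tvar_neq0.
Qed.

Lemma tmonom0 : tmonom R (0 : 'rV[int]_mu) = 1.
Proof. by apply: big1 => i _; rewrite mxE. Qed.

Lemma tmonom_nat (e : 'X_{1..mu}) :
  tmonom R (\row_i (e i)%:Z) = tofrac ('X_[e] : {mpoly R[i][mu]}).
Proof.
rewrite mpolyXE_id rmorph_prod; apply: eq_bigr => i _.
by rewrite mxE rmorphXn.
Qed.

Lemma tmonom_const d :
  tmonom R (const_mx d%:Z : 'rV[int]_mu) = (\prod_(i < mu) tvar R i) ^+ d.
Proof. by rewrite -prodrXl; apply: eq_bigr => i _; rewrite mxE. Qed.

(** The matrix has polynomial entries and its value at [t = 0] is [-1]. *)
Lemma det_monom_sub1_neq0 n (M : 'M[R[i]]_n) (e : 'X_{1..mu}) (i : 'I_mu) :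
  (0 < e i)%N ->
  \det (tmonom R (\row_i (e i)%:Z) *: map_mx (@tconst R mu) M - 1%:M) != 0.
Proof.
move=> ei; pose Q : 'M[{mpoly R[i][mu]}]_n := 'X_[e] *: map_mx (@mpolyC _ _) M - 1%:M.
have -> : tmonom R (\row_i (e i)%:Z) *: map_mx (@tconst R mu) M - 1%:M
          = map_mx (@tofrac _) Q.
  rewrite tmonom_nat; apply/matrixP => k l.
  by rewrite !mxE rmorphB rmorphM rmorph_nat.
rewrite det_map_mx tofrac_eq0; apply/eqP => Q0.
have /(congr1 (meval (fun=> 0))) := Q0; rewrite meval0 -det_map_mx.
rewrite /Q map_mxB map_mxZ map_mx1 /= mevalX (bigD1 i) //= expr0n.
rewrite eqn0Ngt ei mul0r scale0r sub0r -scaleN1r detZ det1 mulr1 => /eqP.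
by rewrite signr_eq0.
Qed.

End Monomials.

Section FoxCalculus.
Context (R : realType) (mu n : nat) (G : groupType).
Context (alpha : G -> 'rV[int]_mu) (phi : G -> 'M[R[i]]_n).
Hypothesis alphaM : forall g h : G, alpha (g * h)%g = alpha g + alpha h.
Hypothesis phi1 : phi 1%g = 1%:M.
Hypothesis phiM : forall g h : G, phi (g * h)%g = phi g *m phi h.

(** The image of the group element [z] under the ring homomorphism [Phi]. *)
Definition twisted (z : G) : 'M[ratfun R mu]_n :=
  tmonom R (alpha z) *: map_mx (@tconst R mu) (phi z).

Lemma twistedM z z' : twisted (z * z')%g = twisted z *m twisted z'.
Proof.
by rewrite /twisted alphaM phiM tmonomD map_mxM -scalemxAl -scalemxAr scalerA.
Qed.

Lemma twisted1 : twisted 1%g = 1%:M.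
Proof.
have alpha1 : alpha 1%g = 0 by apply: (addrI (alpha 1%g)); rewrite -alphaM mulg1 addr0.
by rewrite /twisted alpha1 tmonom0 scale1r phi1 map_mx1.
Qed.

Context (k : nat) (g : 'I_k.+1 -> G).
Local Notation Phi := (wada_Phi alpha phi g).
Local Notation D j w := (Phi (fox j w)).

Lemma wada_Phi_cat e e' : Phi (e ++ e') = Phi e + Phi e'.
Proof. exact: big_cat. Qed.

Lemma wada_Phi_prefix c e :
  Phi [seq (d.1, c :: d.2) | d <- e] = twisted (weval g [:: c]) *m Phi e.
Proof.
rewrite /wada_Phi big_map mulmx_sumr; apply: eq_bigr => d _ /=.
rewrite -/(twisted _) -/(twisted (weval g d.2)) -(cat1s c) weval_cat twistedM.
exact: (esym (raddfMz (mulmx (twisted (weval g [:: c]))) _ _)).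
Qed.

Lemma fox_cons j c w :
  D j (c :: w) = D j [:: c] + twisted (weval g [:: c]) *m D j w.
Proof. by rewrite /= cats0 wada_Phi_cat wada_Phi_prefix. Qed.

Lemma fox_cat j u v :
  D j (u ++ v) = D j u + twisted (weval g u) *m D j v.
Proof.
elim: u => [|c u IHu].
  by rewrite weval_nil twisted1 mul1mx [Phi _ in RHS]big_nil add0r.
rewrite cat_cons fox_cons IHu (fox_cons j c u) mulmxDr addrA.
rewrite -[c :: u]cat1s weval_cat twistedM mulmxA; reflexivity.
Qed.

Lemma fox_free j w : j \notin map fst w -> D j w = 0.
Proof.
move=> jw; suff -> : fox j w = [::] by apply: big_nil.
elim: w jw => //= c w IHw; rewrite inE negb_or eq_sym => /andP[/negPf-> /IHw ->].
by [].
Qed.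

Lemma fox_gen j i : D j (wgen i) = if i == j then 1%:M else 0.
Proof.
rewrite /= cats0; case: eqP => _; last exact: big_nil.
by rewrite /wada_Phi big_seq1 /= -/(twisted _) weval_nil twisted1.
Qed.

Lemma fox_gen_inv j i :
  D j (winv (wgen i)) = if i == j then - twisted (g i)^-1%g else 0.
Proof.
rewrite /= cats0; case: eqP => _; last exact: big_nil.
by rewrite /wada_Phi big_seq1 /= -/(twisted _) /weval big_seq1.
Qed.

(** The fundamental formula of the free differential calculus: for a letter it
    is the definition of the derivatives, and it is inherited by products since
    [Phi (c w) - 1 = (Phi c - 1) + Phi c (Phi w - 1)]. *)
Lemma fox_fundamental w :
  \sum_j D j w *m (twisted (g j) - 1%:M) = twisted (weval g w) - 1%:M.
Proof.
elim: w => [|c w IHw].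
  rewrite big1 ?weval_nil ?twisted1 ?subrr // => j _.
  by rewrite [Phi _]big_nil mul0mx.
under eq_bigr => j _ do rewrite fox_cons mulmxDl -mulmxA.
rewrite big_split -mulmx_sumr IHw /= -[c :: w]cat1s weval_cat twistedM.
have -> : \sum_j D j [:: c] *m (twisted (g j) - 1%:M)
          = twisted (weval g [:: c]) - 1%:M.
  rewrite (bigD1 c.1 isT) big1 => [|j jc]; last first.
    by rewrite fox_free ?mul0mx // inE.
  case: c => i [] /=; rewrite addr0; last first.
    rewrite fox_gen eqxx mul1mx weval_wgen; reflexivity.
  rewrite -[[:: (i, true)]]/(winv (wgen i)) fox_gen_inv eqxx mulNmx mulmxBr.
  rewrite -twistedM mulVg.
  rewrite twisted1 mulmx1 opprB weval_inv weval_wgen; reflexivity.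
by rewrite mulmxBr mulmx1 addrC subrKA.
Qed.

Lemma wada_denE j : wada_den alpha phi g j = \det (twisted (g j) - 1%:M).
Proof.
rewrite /wada_den /wada_Phi big_cons big_seq1 /= -!/(twisted _).
by rewrite weval_wgen weval_nil twisted1.
Qed.

End FoxCalculus.

(** * Wada's quotient for the torus link *)

Lemma letters_wexp (T : eqType) (j i : T) k :
  j != i -> j \notin map fst (wexp (wgen i) k).
Proof. by move=> ji; elim: k => //= k IHk; rewrite inE negb_or ji. Qed.

Lemma letters_winv (T : eqType) (w : word T) j :
  (j \in map fst (winv w)) = (j \in map fst w).
Proof. by rewrite /winv map_rev mem_rev -map_comp. Qed.

Section TorusLinkWada.
Context (R : realType) (nu p q n : nat) (G : groupType).
Context (alpha : G -> 'rV[int]_nu.+1) (phi : G -> 'M[R[i]]_n).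
Hypothesis alphaM : forall g h : G, alpha (g * h)%g = alpha g + alpha h.
Hypothesis phi1 : phi 1%g = 1%:M.
Hypothesis phiM : forall g h : G, phi (g * h)%g = phi g *m phi h.
Context (m : 'I_nu.+1 -> G) (x y : G).
Local Notation g := (red_gen_val m x y).
Local Notation rels := (@red_relator nu.+1 p q).
Local Notation tw := (twisted alpha phi).
Local Notation D j w := (wada_Phi alpha phi g (fox j w)).
Hypothesis relsP : forall i, weval g (rels i) = 1%g.
Variable c : ratfun R nu.+1.
Hypothesis tw_xp : tw (x ^+ p)%g = c%:M.

Local Notation jx := (lift ord_max ord_max : 'I_nu.+2).
Local Notation jy := (ord_max : 'I_nu.+2).

(** A relator does not involve the generators [m_k] other than its own. *)
Lemma torus_block_free (i k : 'I_nu.+1) : i != k -> k != ord_max ->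
  D (lift ord_max k) (rels i) = 0.
Proof.
move=> ik kmax; apply: fox_free.
have kx : lift ord_max k != jx by rewrite (inj_eq lift_inj).
have ky : lift ord_max k != jy by rewrite eq_sym neq_lift.
have [->|imax] := eqVneq i ord_max.
  by rewrite red_relator_xy map_cat mem_cat negb_or letters_winv !letters_wexp.
have ki : lift ord_max k != lift ord_max i by rewrite (inj_eq lift_inj) eq_sym.
rewrite red_relator_m // /wcomm !map_cat !mem_cat !negb_or !letters_winv.
by rewrite letters_wexp // !ki.
Qed.

(** The derivative of [X m X^-1 m^-1] with respect to [m] is
    [X - X m X^-1 m^-1], and the relator is trivial in [G]. *)
Lemma torus_block_m (i : 'I_nu.+1) : i != ord_max ->
  D (lift ord_max i) (rels i) = (c - 1)%:M.
Proof.
move=> imax; have ix : lift ord_max i != jx by rewrite (inj_eq lift_inj).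
have := relsP i; rewrite red_relator_m // /wcomm !weval_cat !weval_inv.
rewrite weval_exp !weval_wgen red_gen_val_x => rel1.
have DX : D (lift ord_max i) (wexp (wgen jx) p) = 0.
  by apply: fox_free; rewrite letters_wexp.
have DXV : D (lift ord_max i) (winv (wexp (wgen jx) p)) = 0.
  by apply: fox_free; rewrite letters_winv letters_wexp.
rewrite !(fox_cat alphaM phi1 phiM) DX DXV add0r (fox_gen alphaM phi1) eqxx.
rewrite (fox_gen_inv _ _ _ _ (lift ord_max i)) eqxx add0r.
rewrite weval_inv weval_exp !weval_wgen red_gen_val_x !mulmxN mulmxDr mulmx1.
rewrite mulmxN -!(twistedM alphaM phiM) rel1 (twisted1 alphaM phi1) tw_xp.
by rewrite [RHS]raddfB.
Qed.

(** The fundamental formula for the word [x^p] computes [D_x (x^p)] up to the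
    factor [Phi x - 1], without expanding the derivative as a geometric sum. *)
Lemma torus_block_x :
  \det (D jx (rels ord_max)) * \det (tw x - 1%:M) = (c - 1) ^+ n.
Proof.
have xy : jx != jy by rewrite eq_sym neq_lift.
rewrite red_relator_xy (fox_cat alphaM phi1 phiM).
rewrite [X in _ + _ *m X]fox_free ?letters_winv ?letters_wexp // mulmx0 addr0.
rewrite -det_mulmx -det_scalar [X in _ = \det X]raddfB /= -tw_xp; congr (\det _).
have := fox_fundamental alphaM phi1 phiM g (wexp (wgen jx) p).
rewrite (bigD1 jx isT) weval_exp weval_wgen red_gen_val_x => <-.
rewrite big1 => [|j jx']; first by apply: esym; apply: addr0.
by rewrite fox_free ?mul0mx // letters_wexp.
Qed.

(** Each of the [nu] meridian blocks contributes [(c - 1)^n], and the block of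
    [x] contributes [(c - 1)^n] over [det (Phi x - 1)]. *)
Lemma torus_wada_quotient (j : 'I_nu.+2) :
    (forall i, \det (tw (g i) - 1%:M) != 0) ->
  wada_num alpha phi g rels j / wada_den alpha phi g j =
  (-1) ^+ (n * (nu.+1 - j)) *
    ((c - 1) ^+ (n * nu.+1) / (\det (tw x - 1%:M) * \det (tw y - 1%:M))).
Proof.
move=> den0; rewrite (wada_denE alphaM phi1).
rewrite (wada_column (A := fun i k => D k (rels i)) (b := fun k => tw (g k) - 1%:M));
  first last.
- exact: den0.
- by move=> i; rewrite (fox_fundamental alphaM phi1 phiM) relsP (twisted1 alphaM phi1) subrr.
congr (_ * _); rewrite (@det_mxblock_but_col _ _ _ nu) => [|i k ik knu]; last first.
  exact: torus_block_free.
rewrite big_ord_recr /= red_gen_val_y.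
under eq_bigr => i _ do rewrite torus_block_m ?widen_ord_neq_max // det_scalar.
have x0 : \det (tw x - 1%:M) != 0 by have := den0 jx; rewrite red_gen_val_x.
rewrite prodr_const card_ord mulnS exprD exprM; set K := (_ ^+ n) ^+ nu.
have quotient (dD dx dy C : ratfun R nu.+1) : dx != 0 -> dD * dx = C ->
    K * dD / dy = C * K / (dx * dy).
  move=> dx0 <-; rewrite [dD * dx]mulrC -(mulrA dx) -mulf_div divff // mul1r.
  by rewrite [K * dD]mulrC.
exact: quotient x0 torus_block_x.
Qed.

End TorusLinkWada.

Lemma map_diag_mx (F K : pzRingType) n (f : {rmorphism F -> K}) (d : 'rV[F]_n) :
  map_mx f (diag_mx d) = diag_mx (map_mx f d).
Proof. by apply/matrixP => i j; rewrite !mxE rmorphMn. Qed.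

(** Being multiplicative, [sigma n] carries a diagonalization of [rho z] to one
    of [sigma n (rho z)]. *)
Lemma det_twisted_sub1 (R : realType) mu n (P : 'M[R[i]]_2) (c : R[i])
    (T : ratfun R mu) : P \in unitmx -> c != 0 ->
  \det (T *: map_mx (@tconst R mu) (sigma n (P *m diag2 c *m invmx P)) - 1%:M)
  = \prod_(k < n) (T * tconst mu (c ^- (n.-1 - k) * c ^+ k) - 1).
Proof.
move=> Pu c0; rewrite !sigmaM ?unitmx_mul ?unitmx_inv ?Pu ?diag2_unit //.
set S := sigma n P; set S' := sigma n (invmx P).
have SS' : S *m S' = 1%:M by rewrite -sigmaM ?unitmx_inv // mulmxV // sigma1.
rewrite !map_mxM; set f := @tconst R mu.
have fSS' : map_mx f S *m map_mx f S' = 1%:M by rewrite -map_mxM SS' map_mx1.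
rewrite sigma_diag2 // map_diag_mx -[X in _ - X]fSS' scalemxAl scalemxAr.
rewrite -[X in _ - X *m _](mulmx1) -mulmxBl -mulmxBr !det_mulmx mulrAC -det_mulmx.
rewrite fSS' det1 mul1r -diag_const_mx -linearZ -linearB det_diag.
by apply: eq_bigr => k _; rewrite !mxE.
Qed.

(** * Eigenvalues on binary forms *)

Section Expi.
Context (R : realType).
Implicit Types theta : R.

Lemma expi0 : expi (0 : R) = 1.
Proof. by rewrite /expi cos0 sin0. Qed.

Lemma expiD theta theta' : expi (theta + theta') = expi theta * expi theta'.
Proof.
rewrite /expi cosD sinD; simpc; congr (_ +i* _).
by rewrite addrC [cos _ * sin _]mulrC.
Qed.

Lemma expiX theta k : expi theta ^+ k = expi (k%:R * theta).
Proof.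
elim: k => [|k IHk]; first by rewrite mul0r expi0.
by rewrite exprS IHk -natr1 mulrDl mul1r addrC expiD.
Qed.

Lemma expi_neq0 theta : expi theta != 0.
Proof.
apply/eqP => e0; have := expiD theta (- theta); rewrite subrr expi0 e0 mul0r.
by move/eqP; rewrite oner_eq0.
Qed.

Lemma expiV theta : (expi theta)^-1 = expi (- theta).
Proof.
apply: (mulfI (expi_neq0 theta)).
by rewrite divff ?expi_neq0 // -expiD subrr expi0.
Qed.

Lemma expi_pi_nat k : expi (pi * k%:R : R) = (-1) ^+ k.
Proof. by rewrite mulrC -expiX /expi cospi sinpi; congr (_ ^+ k); simpc. Qed.

Lemma expi_addV theta : (expi theta)^-1 + expi theta = (2 * cos theta)%:C.
Proof. by rewrite expiV /expi cosN sinN; simpc; rewrite addNr mulr_natl. Qed.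

Section EigenvalueProduct.
Context (mu : nat) (theta : R) (T : ratfun R mu).
Local Notation tc := (@tconst R mu).

Definition cos_quad (k : nat) : ratfun R mu :=
  T ^+ 2 - 2 * tc (cos (k%:R * theta))%:C * T + 1.

(** [det (Phi z - 1)] for an element [z] with monomial [T] that [rho] sends to a
    conjugate of [diag(e^(i theta), e^(-i theta))]. *)
Definition weight_prod (n : nat) : ratfun R mu :=
  \prod_(k < n) (T * tc (expi theta ^- (n.-1 - k) * expi theta ^+ k) - 1).

Lemma cos_quadE k :
  (T * tc (expi theta ^- k) - 1) * (T * tc (expi theta ^+ k) - 1) = cos_quad k.
Proof.
rewrite /cos_quad !expiX; set u := expi _.
have uVu : tc u^-1 * tc u = 1 by rewrite -rmorphM /= mulVf ?expi_neq0 // rmorph1.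
have uDu : tc u^-1 + tc u = 2 * tc (cos (k%:R * theta))%:C.
  rewrite -rmorphD /= expi_addV -[2 in RHS](rmorph_nat tc) -rmorphM /=.
  by congr tconst; rewrite rmorphM /= rmorph_nat.
rewrite -uDu; have -> : (T * tc u^-1 - 1) * (T * tc u - 1)
  = T ^+ 2 * (tc u^-1 * tc u) - (tc u^-1 + tc u) * T + 1 by ring.
by rewrite uVu mulr1.
Qed.

(** The weights of [sigma n.+2] are those of [sigma n] and two opposite
    extreme ones. *)
Lemma weight_prodSS n : weight_prod n.+2 = weight_prod n * cos_quad n.+1.
Proof.
rewrite /weight_prod big_ord_recl big_ord_recr /= mulrCA; congr (_ * _).
  apply: eq_bigr => k _; congr (T * tconst mu _ - 1).
  rewrite /= /bump /= add1n exprS mulrA; congr (_ * _).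
  have -> : (n.+1 - k.+1)%N = (n.-1 - k).+1.
    by rewrite subSS -{1}(ltn_predK (ltn_ord k)) subSn // -ltnS (ltn_predK (ltn_ord k)).
  by rewrite exprS invfM mulrAC mulVf ?mul1r // expi_neq0.
by rewrite -cos_quadE /bump /= add1n subnn expr0 invr1 subn0 mulr1 mul1r.
Qed.

Lemma weight_prod_even h :
  weight_prod h.*2 = \prod_(0 <= j < h) cos_quad (2 * j + 1).
Proof.
elim: h => [|h IHh]; first by rewrite big_geq // /weight_prod big_ord0.
by rewrite doubleS weight_prodSS IHh big_nat_recr //= mul2n addn1.
Qed.

Lemma weight_prod_odd h :
  weight_prod h.*2.+1 = (T - 1) * \prod_(1 <= j < h.+1) cos_quad (2 * j).
Proof.
elim: h => [|h IHh].
  by rewrite /weight_prod big_ord1 big_geq //= sub0n expr0 invr1 !mulr1.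
by rewrite doubleS weight_prodSS IHh [in RHS]big_nat_recr // mul2n -doubleS mulrA.
Qed.

End EigenvalueProduct.
End Expi.

Lemma iter_conj_diag2 (F : fieldType) (c : F) k P : P \in unitmx ->
  iter k (mulmx (P *m diag2 c *m invmx P)) 1%:M = P *m diag2 (c ^+ k) *m invmx P.
Proof.
move=> Pu; elim: k => [|k IHk] /=.
  rewrite expr0 (_ : diag2 1 = 1%:M) ?mulmx1 ?mulmxV //.
  rewrite -diag_const_mx; congr diag_mx; apply/rowP => i.
  by rewrite !mxE invr1; case: eqP.
rewrite IHk !mulmxA mulmxKV // -!mulmxA; congr (_ *m _); rewrite !mulmxA.
congr (_ *m _); rewrite mulmx_diag; congr diag_mx; apply/rowP => i.
by rewrite !mxE; case: eqP => _; rewrite exprS ?invfM.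
Qed.

(** * The twisted Alexander polynomial *)

Theorem theorem5p1 (R : realType) (mu p q : nat) (hmu : (1 <= mu)%N)
    (hp : (0 < p)%N) (hq : (0 < q)%N) (hpq : coprime p q)
    (r s : int) (hrs : p%:Z * s + q%:Z * r = 1)
    (G : groupType) (m : 'I_mu -> G) (x y l : G)
    (hG : presents (@link_relator mu p q r s) (link_gen_val m x y l))
    (alpha : G -> 'rV[int]_mu) (halpha : is_abelianization p q m x y alpha)
    (rho : G -> 'M[R[i]]_2) (hrho : SL_representation rho)
    (hirr : irreducible_representation rho)
    (a b : nat) (ha : (a <= p)%N) (hb : (b <= q)%N)
    (hx : conjugate_mx (rho x) (diag2 (expi (pi * a%:R / p%:R))))
    (hy : conjugate_mx (rho y) (diag2 (expi (pi * b%:R / q%:R))))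
    (n : nat) (hn : (1 <= n)%N) :
  let rho_n := fun g : G => sigma n (rho g) in
  let t : ratfun R mu := \prod_(i < mu) tvar R i in
  let cosc (theta : R) : ratfun R mu := tconst mu (cos theta)%:C in
  (~~ odd n ->
    is_twisted_alexander alpha rho_n (red_gen_val m x y) (@red_relator mu p q)
      ((t ^+ (p * q) - (-1) ^+ a) ^+ (n * mu) /
       \prod_(0 <= j < n./2)
         ((t ^+ (2 * q) - 2 * cosc ((2 * j + 1)%:R * a%:R * pi / p%:R) * t ^+ q + 1)
          * (t ^+ (2 * p) - 2 * cosc ((2 * j + 1)%:R * b%:R * pi / q%:R) * t ^+ p + 1))))
  /\
  (odd n ->
    is_twisted_alexander alpha rho_n (red_gen_val m x y) (@red_relator mu p q)
      ((t ^+ (p * q) - 1) ^+ (n * mu) /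
       ((t ^+ p - 1) * (t ^+ q - 1) *
        \prod_(1 <= j < (n.-1)./2.+1)
          ((t ^+ (2 * q) - 2 * cosc ((2 * j)%:R * a%:R * pi / p%:R) * t ^+ q + 1)
           * (t ^+ (2 * p) - 2 * cosc ((2 * j)%:R * b%:R * pi / q%:R) * t ^+ p + 1))))).
Proof.
move=> rho_n t cosc.
case: mu hmu m hG alpha halpha @t @cosc => // nu _ m hG alpha halpha t cosc.
have [alphaM alpha_m alpha_x alpha_y] := halpha.
have [rho1 rhoM rho_det] := hrho.
have rho_unit z : rho z \in unitmx by rewrite unitmxE rho_det unitr1.
have phi1 : rho_n 1%g = 1%:M by rewrite /rho_n rho1 sigma1.
have phiM z z' : rho_n (z * z')%g = rho_n z *m rho_n z'.
  by rewrite /rho_n rhoM sigmaM.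
have hred := presents_reduced hG.
have relsP i : weval (red_gen_val m x y) (red_relator p q i) = 1%g.
  by rewrite -(weval_nil (red_gen_val m x y)); apply/(proj2 hred)/weq_rel; exists i.
have tw_neq0 z (e : 'X_{1..nu.+1}) i : alpha z = \row_j (e j)%:Z -> (0 < e i)%N ->
    \det (twisted alpha rho_n z - 1%:M) != 0.
  by move=> az ei; rewrite /twisted az; apply: det_monom_sub1_neq0 ei.
have constE d : const_mx d%:Z = \row_j ([multinom d | _ < nu.+1] j)%:Z :> 'rV[int]_nu.+1.
  by apply/rowP => j; rewrite !mxE mnmE.
have den0 j : \det (twisted alpha rho_n (red_gen_val m x y j) - 1%:M) != 0.
  case: (unliftP ord_max j) => [k|] ->.
    have [->|kmax] := eqVneq k ord_max.
      rewrite red_gen_val_x; apply: (tw_neq0 _ [multinom q | _ < nu.+1] ord0).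
        by rewrite alpha_x constE.
      by rewrite mnmE.
    rewrite red_gen_val_m //; apply: (tw_neq0 _ U_(k)%MM k).
      by rewrite alpha_m; apply/rowP => i; rewrite !mxE mnm1E (eq_sym k) eqxx; case: eqP.
    by rewrite mnm1E eqxx.
  rewrite red_gen_val_y; apply: (tw_neq0 _ [multinom p | _ < nu.+1] ord0).
    by rewrite alpha_y constE.
  by rewrite mnmE.
have [P Pu rho_x] := hx; have [Q Qu rho_y] := hy.
set thx := pi * a%:R / p%:R in rho_x; set thy := pi * b%:R / q%:R in rho_y.
have expip : expi thx ^+ p = (-1) ^+ a.
  by rewrite expiX -expi_pi_nat /thx mulrC divfK // pnatr_eq0 -lt0n.
have det_x : \det (twisted alpha rho_n x - 1%:M) = weight_prod thx (t ^+ q) n.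
  rewrite /twisted alpha_x tmonom_const /rho_n rho_x.
  exact: det_twisted_sub1 Pu (expi_neq0 _).
have det_y : \det (twisted alpha rho_n y - 1%:M) = weight_prod thy (t ^+ p) n.
  rewrite /twisted alpha_y tmonom_const /rho_n rho_y.
  exact: det_twisted_sub1 Qu (expi_neq0 _).
(* [rho (x^p)] is the scalar [(-1)^a], which is its own inverse. *)
have rho_xp : rho (x ^+ p)%g = diag2 ((-1) ^+ a).
  have -> : rho (x ^+ p)%g = iter p (mulmx (rho x)) 1%:M.
    by elim: (p) => [|k IHk]; rewrite ?rho1 // expgS rhoM IHk.
  rewrite rho_x (iter_conj_diag2 _ _ Pu) expip.
  have -> : diag2 ((-1) ^+ a) = ((-1) ^+ a)%:M :> 'M[R[i]]_2.
    rewrite -diag_const_mx; congr diag_mx; apply/rowP => i.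
    by rewrite !mxE invr_sign if_same.
  by rewrite scalar_mxC mulmxK.
pose c : ratfun R nu.+1 := t ^+ (p * q) * ((-1) ^+ a) ^+ n.-1.
have alpha_xp : alpha (x ^+ p)%g = const_mx (p * q)%:Z.
  elim: (p) => [|k IHk].
    apply: (addrI (alpha 1%g)); rewrite -alphaM mulg1.
    by apply/rowP => i; rewrite !mxE addr0.
  by rewrite expgS alphaM alpha_x IHk; apply/rowP => i; rewrite !mxE -PoszD.
have tw_xp : twisted alpha rho_n (x ^+ p)%g = c%:M.
  rewrite /twisted alpha_xp tmonom_const /rho_n rho_xp sigma_diag2 ?signr_eq0 //.
  rewrite map_diag_mx -linearZ -diag_const_mx; congr diag_mx; apply/rowP => k.
  rewrite !mxE -exprVn invr_sign -exprD subnK; last first.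
    by rewrite -ltnS (ltn_predK (ltn_ord k)).
  by rewrite -/t /c !rmorphXn rmorphN1.
have [F FE] : exists F, F = (c - 1) ^+ (n * nu.+1)
    / (weight_prod thx (t ^+ q) n * weight_prod thy (t ^+ p) n) by eexists.
have FP : is_twisted_alexander alpha rho_n (red_gen_val m x y) (@red_relator nu.+1 p q) F.
  split=> // [|j _].
    by exists ord0; rewrite (wada_denE alphaM phi1).
  exists (odd (nu.+1 - j)), (fun=> 0).
  apply: (etrans (torus_wada_quotient alphaM phi1 phiM relsP tw_xp j den0)).
  rewrite FE -det_x -det_y -oddM signr_odd; congr (_ * _); apply: esym.
  rewrite -[RHS]mulr1; congr (_ * _).
  by apply: big1 => i _; rewrite mulr0.
have cos_quad_x k : cos_quad thx (t ^+ q) k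
    = t ^+ (2 * q) - 2 * cosc (k%:R * a%:R * pi / p%:R) * t ^+ q + 1.
  rewrite /cos_quad -exprM mulnC /cosc /thx; congr (_ - _ * tconst _ (cos _)%:C * _ + _).
  by rewrite [pi * _]mulrC !mulrA.
have cos_quad_y k : cos_quad thy (t ^+ p) k
    = t ^+ (2 * p) - 2 * cosc (k%:R * b%:R * pi / q%:R) * t ^+ p + 1.
  rewrite /cos_quad -exprM mulnC /cosc /thy; congr (_ - _ * tconst _ (cos _)%:C * _ + _).
  by rewrite [pi * _]mulrC !mulrA.
split=> n_parity.
- set F' := _ / _; suff <- : F = F' by []; rewrite FE /F' {F' F FP FE}.
  have [h hE nE] : exists2 h, n./2 = h & n = h.*2.
    by exists n./2; rewrite // -[LHS]odd_double_half (negPf n_parity).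
  congr (_ / _).
    (* The sign [(-1)^a] taken out of [c - 1] disappears in an even power. *)
    rewrite exprM [RHS]exprM; congr (_ ^+ _).
    have -> : c = t ^+ (p * q) * (-1) ^+ a.
      congr (_ * _); rewrite -exprM mulnC exprM -signr_odd.
      by move: hn n_parity; case: (n) => // k _ /=; rewrite negbK => ->.
    have -> : t ^+ (p * q) * (-1) ^+ a - 1 = (-1) ^+ a * (t ^+ (p * q) - (-1) ^+ a).
      by rewrite mulrBr -exprD addnn -(signr_odd _ a.*2) odd_double mulrC.
    by rewrite exprMn -exprM -(signr_odd _ (a * n)) oddM (negPf n_parity) andbF mul1r.
  rewrite hE nE !weight_prod_even -big_split; apply: eq_bigr => j _ /=.
  by rewrite cos_quad_x cos_quad_y.
- set F' := _ / _; suff <- : F = F' by []; rewrite FE /F' {F' F FP FE}.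
  have [h nE] : exists h, n = h.*2.+1.
    by exists n./2; rewrite -[LHS]odd_double_half n_parity.
  have -> : c = t ^+ (p * q).
    rewrite /c -exprM -(signr_odd _ (a * n.-1)) oddM.
    by rewrite nE /= odd_double andbF mulr1.
  congr (_ / _).
  have -> : (n.-1)./2 = h by rewrite nE /= doubleK.
  rewrite nE !weight_prod_odd mulrACA.
  congr (_ * _); first by rewrite mulrC.
  by rewrite -big_split; apply: eq_bigr => j _ /=; rewrite cos_quad_x cos_quad_y.
Qed.
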